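(* Let $\mathcal{A}=(\operatorname{QGr}A,\pi A,(1))$ be a geometric noncommutative $\mathbb{P}^n$ and let $\mathcal{T}=\mathcal{T}(\mathcal{A})=(E,\sigma,\mathcal{L})$ be its associated geometric triple. Then there is an injective function $$\mathrm{Obj}\big(\mathscr{GT}(\mathbb{P}^n)/\mathcal{T}\big)\longrightarrow \operatorname{Aut}(E\uparrow\mathbb{P}^n)\sigma\times(\ker\mathrm{Res}_E)^{\mathbb{N}}\times\operatorname{Aut}(\mathbb{P}^n).$$
   Context: Let $k$ be an algebraically closed field of characteristic $0$; $\mathbb{P}^n=\mathbb{P}^n_k$. A connected graded ($\mathbb{N}$-graded, $A_0=k$) $k$-algebra $A$ is a coordinate ring of a noncommutative $\mathbb{P}^n$ if it is a Noetherian domain, is AS-regular (Artin–Schelter regular) of dimension $n+1$, is generated in degree 1, and has Hilbert series $(1-t)^{-n-1}$. Then the triple $\mathcal{A}=(\operatorname{QGr}A,\pi A,(1))$ is called a noncommutative $\mathbb{P}^n$; here $\operatorname{QGr}A$ is the quotient of the category $\operatorname{Gr}A$ of $\mathbb{Z}$-graded right $A$-modules with degree $0$ morphisms by the Serre subcategory of torsion modules (those $M$ all of whose elements $x$ satisfy $xA_{\ge s}=0$ for some $s$), $\pi$ is the quotient functor and $(1)$ is the grading shift. A quadratic algebra $A=T(V)/(R)$, $V$ a finite-dimensional vector space, $R\subseteq V\otimes V$, is geometric if there is a triple $(E,\sigma,\mathcal{L})$ where $j\colon E\to\mathbb{P}(V^* )$ is a closed $k$-subscheme, $\mathcal{L}=j^*\mathcal{O}_{\mathbb{P}(V^*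 )}(1)$ and $\sigma$ is a $k$-automorphism of $E$ such that (1) the subscheme $\mathcal{V}(R)\subset\mathbb{P}(V^* )\times\mathbb{P}(V^* )$ defined by the bilinear forms in $R$ is the graph of $\sigma$, and (2) with the identification $H^0(E,\mathcal{L})=H^0(\mathbb{P}(V^* ),\mathcal{O}(1))=V$, the map $\mu\colon H^0(E,\mathcal{L})\otimes H^0(E,\mathcal{L})\to H^0(E,\mathcal{L}\otimes_{\mathcal{O}_E}\sigma^*\mathcal{L})$, $v\otimes w\mapsto v\otimes(w\circ\sigma)$, has kernel $R$. A geometric noncommutative $\mathbb{P}^n$ is a noncommutative $\mathbb{P}^n$ whose coordinate ring $A$ is geometric; $(E,\sigma,\mathcal{L})$, with $\mathbb{P}(A_1^* )$ identified linearly with $\mathbb{P}^n$, is its associated geometric triple. Since $\mathcal{L}$ is the restriction of $\mathcal{O}(1)$, it is regarded as determined by the closed subscheme $E\subseteq\mathbb{P}^n$. $\mathscr{GT}(\mathbb{P}^n)$ is the groupoid whose objects are the triples $(E,\sigma,\mathcal{L})$ associated to geometric noncommutative $\mathbb{P}^n$s, and whose morphisms $(E,\sigma,\mathcal{L})\to(E',\sigma',\mathcal{L}')$ (called geometric systems) are the families $\bar\tau=\{\tau_i\mid i\in\mathbb{N}\}$ with $\tau_i\in\operatorname{Aut}(\mathbb{P}^n)$ such that each $\tau_i^E:=\tau_i|_E\colon E\to E'$ is an isomorphism and $\tau_{i+1}^E\sigma=\sigma'\tau_i^E$ for all $i\in\mathbb{N}$ (with $0\in\mathbb{N}$). Composition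 is $\bar\tau'\circ\bar\tau=\{\tau_i'\circ\tau_i\}$. The slice category $\mathscr{GT}(\mathbb{P}^n)/\mathcal{T}$ has as objects the morphisms $\mathcal{T}'\to\mathcal{T}$ in $\mathscr{GT}(\mathbb{P}^n)$ ($\mathcal{T}'$ arbitrary) and as morphisms the commuting triangles over $\mathcal{T}$; $\mathrm{Obj}$ denotes its collection of objects. For a closed subscheme $E\subseteq\mathbb{P}^n$: $\operatorname{Aut}(E\uparrow\mathbb{P}^n)=\{\sigma\in\operatorname{Aut}E\mid \exists\,\hat\sigma\in\operatorname{Aut}\mathbb{P}^n,\ \hat\sigma|_E=\sigma\}$, $\operatorname{Aut}(\mathbb{P}^n\downarrow E)=\{\rho\in\operatorname{Aut}\mathbb{P}^n\mid\rho(E)=E\}$, and $\mathrm{Res}_E\colon\operatorname{Aut}(\mathbb{P}^n\downarrow E)\to\operatorname{Aut}(E\uparrow\mathbb{P}^n)$ is the (surjective) restriction homomorphism. $\operatorname{Aut}(E\uparrow\mathbb{P}^n)\sigma$ is the right coset $\{\epsilon\sigma\mid\epsilon\in\operatorname{Aut}(E\uparrow\mathbb{P}^n)\}$ in $\operatorname{Aut}(E)$, and $(\ker\mathrm{Res}_E)^{\mathbb{N}}$ is the set of $\mathbb{N}$-indexed sequences of elements of $\ker\mathrm{Res}_E$. *)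

(* Defs.v *)
From HB Require Import structures.
From mathcomp Require Import all_boot all_order all_algebra.
From mathcomp Require Import boolp.
From mathcomp.multinomials Require Import monalg.

Set Implicit Arguments.
Unset Strict Implicit.
Unset Printing Implicit Defensive.

Import GRing.Theory.
Local Open Scope ring_scope.

Definition is_grading (I : eqType) (V : zmodType) (D : I -> V -> Prop) : Prop :=
  [/\ forall i, D i 0 /\ (forall u v, D i u -> D i v -> D i (u - v)),
      forall v, exists (s : seq I) (f : I -> V),
        [/\ uniq s, forall i, D i (f i) & v = \sum_(i <- s) f i]
    & forall (s : seq I) (f : I -> V), uniq s -> (forall i, D i (f i)) ->
        \sum_(i <- s) f i = 0 -> forall i, i \in s -> f i = 0].

Record cgalg (k : fieldType) := CGAlg {
  cgcar :> algType k;
  gdeg : nat -> cgcar -> Prop;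
  gdeg_grading : is_grading gdeg;
  gdeg_mul : forall i j a b, gdeg i a -> gdeg j b -> gdeg (i + j)%N (a * b);
  gdeg_connected : forall a, gdeg 0%N a <-> exists c : k, a = c%:A }.

(* Left modules over [B]; right modules over a graded algebra [A] are the case
   [B := A^c]. *)
Record grmod (B : nzRingType) (gB : nat -> B -> Prop) := GrMod {
  mcar :> lmodType B;
  mdeg : int -> mcar -> Prop;
  mdeg_grading : is_grading mdeg;
  mdeg_scale : forall i j (b : B) (x : mcar),
    gB i b -> mdeg j x -> mdeg (i%:Z + j) (b *: x) }.

Section GradedModules.
Variables (B : nzRingType) (gB : nat -> B -> Prop).
Local Notation grmod := (grmod gB).

Definition grhom (M N : grmod) (f : {linear M -> N}) : Prop :=
  forall i x, mdeg i x -> mdeg i (f x).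

Definition gr_projective (P : grmod) : Prop :=
  forall (M N : grmod) (g : {linear M -> N}) (f : {linear P -> N}),
    grhom g -> grhom f -> (forall y, exists x, g x = y) ->
    exists2 h : {linear P -> M}, grhom h & forall x, g (h x) = f x.

Record grres (M : grmod) := GrRes {
  rob : nat -> grmod;
  rdiff : forall i, {linear rob i.+1 -> rob i};
  raug : {linear rob 0%N -> M};
  rob_proj : forall i, gr_projective (rob i);
  rdiff_hom : forall i, grhom (rdiff i);
  raug_hom : grhom raug;
  raug_onto : forall y, exists x, raug x = y;
  raug_exact : forall x, raug x = 0 <-> exists y, rdiff 0 y = x;
  rdiff_exact : forall i x, rdiff i x = 0 <-> exists y, rdiff i.+1 y = x }.

Definition pd_le (M : grmod) (d : nat) : Prop :=
  exists Q : grres M, forall i, (d < i)%N -> forall x : rob Q i, x = 0.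

Definition gldim_eq (d : nat) : Prop :=
  (forall M, pd_le M d) /\ (exists M, forall e, pd_le M e -> (d <= e)%N).

Definition left_noetherian : Prop :=
  forall J : B -> Prop,
    J 0 -> (forall a x y, J x -> J y -> J (a * x + y)) ->
    exists (m : nat) (g : 'I_m -> B),
      (forall i, J (g i)) /\
      (forall x, J x -> exists c : 'I_m -> B, x = \sum_i c i * g i).

End GradedModules.

Section Regular.
Variables (k : fieldType) (A : cgalg k).

Local Notation rmod := (@grmod A^c (@gdeg k A)).

(* [l]-shifted degree on the regular module: [A(l)] has component [A_(l + j)] in
   degree [j], zero when [l + j < 0]. *)
Definition zdeg (z : int) (a : A) : Prop :=
  match z with Posz m => gdeg m a | Negz _ => a = 0 end.

(* The trivial right module [A / A_(>= 1)], up to isomorphism. *)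
Definition is_trivial (K : rmod) : Prop :=
  exists u : K,
    [/\ u <> 0, mdeg 0 u,
        forall x : K, exists c : k, x = (c%:A : A^c) *: u
      & forall i (a : A), (0 < i)%N -> gdeg i a ->
          forall x : K, (a : A^c) *: x = 0].

Section Ext.
Variables (K : rmod) (Q : grres K) (l : int).

Definition cochain i (f : {linear rob Q i -> (A^c)^o}) : Prop :=
  forall j x, mdeg j x -> zdeg (l + j) (f x).

Definition cocycle i (f : {linear rob Q i -> (A^c)^o}) : Prop :=
  cochain f /\ forall y, f (rdiff Q i y) = 0.

Definition coboundary i : {linear rob Q i -> (A^c)^o} -> Prop :=
  match i with
  | 0%N => fun f => forall x, f x = 0
  | j.+1 => fun f => exists2 g : {linear rob Q j -> (A^c)^o},
                       cochain g & forall x, f x = g (rdiff Q j x)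
  end.

(* [Ext^i_(Gr A)(K, A(l)) = 0], computed on [Q] *)
Definition ext_zero i : Prop :=
  forall f : {linear rob Q i -> (A^c)^o}, cocycle f -> coboundary f.

(* [Ext^i_(Gr A)(K, A(l))] is one-dimensional over [k], computed on [Q] *)
Definition ext_line i : Prop :=
  exists f0 : {linear rob Q i -> (A^c)^o},
    [/\ cocycle f0, ~ coboundary f0
      & forall f : {linear rob Q i -> (A^c)^o}, cocycle f ->
          exists (c : k) (b : {linear rob Q i -> (A^c)^o}),
            coboundary b /\
            forall x, (f x : A) = c *: (f0 x : A) + (b x : A)].

End Ext.

Definition gorenstein (d : nat) : Prop :=
  exists (K : rmod) (Q : grres K) (l0 : int),
    is_trivial K /\
    forall i l, if (i == d) && (l == l0) then ext_line Q l i else ext_zero Q l i.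

Definition homog_basis (i m : nat) (b : 'I_m -> A) : Prop :=
  (forall j, gdeg i (b j)) /\
  (forall a, gdeg i a -> exists! c : {ffun 'I_m -> k}, a = \sum_j c j *: b j).

Definition hilbert_fun (h : nat -> nat) : Prop :=
  forall i, exists b : 'I_(h i) -> A, homog_basis i b.

(* For a finitely generated connected graded algebra the growth function can be
   taken to be [m |-> \sum_(i <= m) \dim A_i]. *)
Definition finite_gkdim : Prop :=
  exists2 h, hilbert_fun h &
    exists C e : nat, forall m, (\sum_(i < m.+1) h i <= C * m.+1 ^ e)%N.

Definition as_regular (d : nat) : Prop :=
  [/\ @gldim_eq A^c (@gdeg k A) d, finite_gkdim & gorenstein d].

Definition gen_deg1 : Prop :=
  forall X : A -> Prop,
    (forall c : k, X c%:A) -> (forall a, gdeg 1%N a -> X a) ->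
    (forall a b, X a -> X b -> X (a + b)) ->
    (forall a b, X a -> X b -> X (a * b)) -> forall a, X a.

(* [H_A(t) (1 - t)^(n+1) = 1] as formal power series *)
Definition hilbert_Pn (n : nat) : Prop :=
  exists2 h, hilbert_fun h &
    forall d : nat,
      \sum_(i < d.+1) (h i)%:Z * ((1 - 'X : {poly int}) ^+ n.+1)`_(d - i)%N
        = (d == 0%N)%:R.

Definition coord_ring_Pn (n : nat) : Prop :=
  [/\ left_noetherian A /\ left_noetherian A^c,
      forall a b : A, a * b = 0 -> a = 0 \/ b = 0,
      as_regular n.+1, gen_deg1 & hilbert_Pn n].

End Regular.

(* A [k]-scheme is represented by its functor of points on (nonzero)
   commutative [k]-algebras, and a morphism of [k]-schemes by a natural
   transformation; by Yoneda this loses nothing. *)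
Section Functors.
Variable k : fieldType.

Record kfunctor := KFunctor {
  fob :> comAlgType k -> Type;
  fmap : forall R S : comAlgType k, {lrmorphism R -> S} -> fob R -> fob S;
  fmap_id : forall (R : comAlgType k) x, fmap (idfun : {lrmorphism R -> R}) x = x;
  fmap_comp : forall (R S T : comAlgType k) (g : {lrmorphism S -> T})
    (f : {lrmorphism R -> S}) x, fmap (g \o f) x = fmap g (fmap f x) }.

Record hom (X Y : kfunctor) := Hom {
  happ :> forall R, X R -> Y R;
  hnat : forall (R S : comAlgType k) (f : {lrmorphism R -> S}) (x : X R),
    happ (fmap f x) = fmap f (happ x) }.

Lemma hom_ext (X Y : kfunctor) (f g : hom X Y) :
  (forall R (x : X R), f R x = g R x) -> f = g.
Proof.
case: f g => [f fn] [g gn] /= fg.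
have e : f = g by apply: functional_extensionality_dep => R; apply: funext.
by rewrite -e in gn *; congr Hom; apply: Prop_irrelevance.
Qed.

Lemma hid_nat (X : kfunctor) (R S : comAlgType k) (f : {lrmorphism R -> S}) (x : X R) :
  fmap f x = fmap f x.
Proof. by []. Qed.

Definition hid (X : kfunctor) : hom X X := Hom (@hid_nat X).

Lemma hcomp_nat (X Y Z : kfunctor) (g : hom Y Z) (f : hom X Y)
    (R S : comAlgType k) (u : {lrmorphism R -> S}) (x : X R) :
  g S (f S (fmap u x)) = fmap u (g R (f R x)).
Proof. by rewrite !hnat. Qed.

Definition hcomp (X Y Z : kfunctor) (g : hom Y Z) (f : hom X Y) : hom X Z :=
  Hom (hcomp_nat g f).

Definition is_iso (X Y : kfunctor) (f : hom X Y) : Prop :=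
  exists g : hom Y X, hcomp g f = hid X /\ hcomp f g = hid Y.

Record aut (X : kfunctor) := Aut { ahom :> hom X X; aiso : is_iso ahom }.

Lemma hid_iso (X : kfunctor) : is_iso (hid X).
Proof. by exists (hid X); split; apply: hom_ext. Qed.

Definition aut_id (X : kfunctor) : aut X := Aut (hid_iso X).

Lemma hcomp_iso (X Y Z : kfunctor) (g : hom Y Z) (f : hom X Y) :
  is_iso g -> is_iso f -> is_iso (hcomp g f).
Proof.
move=> [g' [g'g gg']] [f' [f'f ff']]; exists (hcomp f' g').
have E (U W : kfunctor) (a : hom W U) (b : hom U W) :
    hcomp a b = hid U -> forall R x, a R (b R x) = x.
  by move=> ab R x; have -> : a R (b R x) = hcomp a b R x by []; rewrite ab.
split; apply: hom_ext => R x /=; first by rewrite (E _ _ _ _ g'g) (E _ _ _ _ f'f).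
by rewrite (E _ _ _ _ ff') (E _ _ _ _ gg').
Qed.

Definition aut_comp (X : kfunctor) (g f : aut X) : aut X :=
  Aut (hcomp_iso (aiso g) (aiso f)).

End Functors.

(* Rank one direct summands of [R^(n+1)]: images of idempotent matrices which
   have rank one at every field-valued point of [Spec R]. *)
Definition is_line (R : comNzRingType) (n : nat) (L : 'rV[R]_n.+1 -> Prop) : Prop :=
  exists e : 'M[R]_n.+1,
    [/\ e *m e = e, forall v, L v <-> v *m e = v
      & forall (K : fieldType) (f : {rmorphism R -> K}), \rank (map_mx f e) = 1%N].

Record line (R : comNzRingType) (n : nat) := Line {
  lpt :> 'rV[R]_n.+1 -> Prop;
  lptP : is_line lpt }.

Section ProjectiveSpace.
Variables (k : fieldType) (n : nat).

Lemma line_ext (R : comNzRingType) (p q : line R n) :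
  (forall v, p v <-> q v) -> p = q.
Proof.
case: p q => [p pP] [q qP] /= pq.
have e : p = q by apply: funext => v; apply: propext.
by rewrite -e in qP *; congr Line; apply: Prop_irrelevance.
Qed.

Definition line_push (R S : comNzRingType) (f : {rmorphism R -> S}) (p : line R n)
    (w : 'rV[S]_n.+1) : Prop :=
  exists (m : nat) (s : 'rV[S]_m) (X : 'M[R]_(m, n.+1)),
    (forall i, p (row i X)) /\ w = s *m map_mx f X.

Lemma line_pushE (R S : comNzRingType) (f : {rmorphism R -> S}) (p : line R n) e :
  e *m e = e -> (forall v, p v <-> v *m e = v) ->
  forall w, line_push f p w <-> w *m map_mx f e = w.
Proof.
move=> ee pe w; split=> [[m [s [X [pX ->]]]]|we].
  have Xe : X *m e = X.
    by apply/row_matrixP => i; rewrite row_mul; apply/pe.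
  by rewrite -mulmxA -map_mxM Xe.
exists n.+1, w, e; split; last by rewrite we.
by move=> i; apply/pe; rewrite -row_mul ee.
Qed.

Lemma line_push_line (R S : comNzRingType) (f : {rmorphism R -> S}) (p : line R n) :
  is_line (line_push f p).
Proof.
have [e [ee pe re]] := lptP p; exists (map_mx f e); split.
- by rewrite -map_mxM ee.
- exact: line_pushE.
- move=> K g; rewrite -(re K (g \o f)).
  by congr mxrank; apply/matrixP => i j; rewrite !mxE.
Qed.

Definition line_map (R S : comAlgType k) (f : {lrmorphism R -> S})
  (p : line R n) : line S n := Line (line_push_line f p).

Lemma line_map_id (R : comAlgType k) (p : line R n) :
  line_map (idfun : {lrmorphism R -> R}) p = p.
Proof.
have [e [ee pe _]] := lptP p; apply: line_ext => v /=.
apply: iff_trans (line_pushE _ ee pe v) _; rewrite pe.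
by have -> : map_mx idfun e = e by apply/matrixP => i j; rewrite mxE.
Qed.

Lemma line_map_comp (R S T : comAlgType k) (g : {lrmorphism S -> T})
    (f : {lrmorphism R -> S}) (p : line R n) :
  line_map (g \o f) p = line_map g (line_map f p).
Proof.
have [e [ee pe _]] := lptP p; apply: line_ext => v /=.
apply: iff_trans (line_pushE _ ee pe v) _; apply: iff_sym.
have ee' : map_mx f e *m map_mx f e = map_mx f e by rewrite -map_mxM ee.
apply: iff_trans (@line_pushE _ _ g (line_map f p) _ ee' _ v) _.
  exact: (@line_pushE _ _ f p).
by have -> : map_mx g (map_mx f e) = map_mx (g \o f) e
  by apply/matrixP => i j; rewrite !mxE.
Qed.

Definition Pn : kfunctor k := KFunctor line_map_id line_map_comp.

(* A closed subscheme is a closed subfunctor: its inverse image along any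
   [R]-point is the closed subscheme of [Spec R] cut out by some subset of
   [R]. *)
Record closed_sub := ClosedSub {
  cpt : forall R : comAlgType k, Pn R -> Prop;
  cptP : forall (R : comAlgType k) (p : Pn R), exists J : R -> Prop,
    forall (S : comAlgType k) (f : {lrmorphism R -> S}),
      cpt (fmap f p) <-> (forall a, J a -> f a = 0) }.

Lemma cpt_map (E : closed_sub) (R S : comAlgType k) (f : {lrmorphism R -> S}) (p : Pn R) :
  cpt E p -> cpt E (fmap f p).
Proof.
have [J HJ] := cptP E p; rewrite -{1}(fmap_id p) => /HJ J0.
by apply/HJ => a /J0 /= ->; rewrite rmorph0.
Qed.

Definition sub_ob (E : closed_sub) (R : comAlgType k) : Type := {p : Pn R | cpt E p}.

Definition sub_map (E : closed_sub) (R S : comAlgType k) (f : {lrmorphism R -> S})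
  (x : sub_ob E R) : sub_ob E S :=
  exist _ (fmap f (sval x)) (cpt_map f (svalP x)).

Lemma sub_map_id (E : closed_sub) (R : comAlgType k) (x : sub_ob E R) :
  sub_map (idfun : {lrmorphism R -> R}) x = x.
Proof. by case: x => p Ep; apply: eq_exist; apply: fmap_id. Qed.

Lemma sub_map_comp (E : closed_sub) (R S T : comAlgType k)
    (g : {lrmorphism S -> T}) (f : {lrmorphism R -> S}) (x : sub_ob E R) :
  sub_map (g \o f) x = sub_map g (sub_map f x).
Proof. by case: x => p Ep; apply: eq_exist; apply: fmap_comp. Qed.

Definition sub_functor (E : closed_sub) : kfunctor k :=
  KFunctor (@sub_map_id E) (@sub_map_comp E).
Coercion sub_functor : closed_sub >-> kfunctor.

Definition maps_into (t : hom Pn Pn) (E E' : closed_sub) : Prop :=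
  forall R (p : Pn R), cpt E p -> cpt E' (t R p).

Lemma restr_nat (t : hom Pn Pn) (E E' : closed_sub) (tE : maps_into t E E')
    (R S : comAlgType k) (f : {lrmorphism R -> S}) (x : E R) :
  exist (@cpt E' S) (t S (sval (fmap f x))) (tE S _ (svalP (fmap f x)))
  = fmap f (exist (@cpt E' R) (t R (sval x)) (tE R _ (svalP x)) : E' R).
Proof. by apply: eq_exist; rewrite /= hnat. Qed.

Definition restr (t : hom Pn Pn) (E E' : closed_sub) (tE : maps_into t E E') :
  hom E E' :=
  @Hom k E E' (fun R x => exist (@cpt E' R) (t R (sval x)) (tE R _ (svalP x)))
    (restr_nat tE).

Definition AutUp (E : closed_sub) : Type :=
  {s : aut E | exists2 t : aut Pn,
     maps_into t E E & forall R (x : E R), sval (s R x) = t R (sval x)}.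

Definition preserves (t : aut Pn) (E : closed_sub) : Prop :=
  forall R (q : Pn R), (exists2 p, cpt E p & t R p = q) <-> cpt E q.

Definition AutDown (E : closed_sub) : Type := {t : aut Pn | preserves t E}.

Lemma preserves_into (t : aut Pn) (E : closed_sub) :
  preserves t E -> maps_into t E E.
Proof. by move=> tE R p Ep; apply/tE; exists p. Qed.

Lemma restr_iso (t : aut Pn) (E : closed_sub) (tE : preserves t E) :
  is_iso (restr (preserves_into tE)).
Proof.
have [t' [t't tt']] := aiso t.
have t'K R p : t' R (t R p) = p.
  by have -> : t' R (t R p) = hcomp t' t R p by []; rewrite t't.
have tK R p : t R (t' R p) = p.
  by have -> : t R (t' R p) = hcomp t t' R p by []; rewrite tt'.
have t'E : maps_into t' E E.
  by move=> R p /tE[q Eq <-]; rewrite t'K.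
exists (restr t'E); split; apply: hom_ext => R [p Ep];
  by apply: eq_exist; rewrite /= ?t'K ?tK.
Qed.

Lemma Res_up (E : closed_sub) (t : AutDown E) :
  exists2 u : aut Pn, maps_into u E E &
    forall R (x : E R),
      sval (Aut (restr_iso (svalP t)) R x) = u R (sval x).
Proof. by exists (sval t) => //; apply: preserves_into (svalP t). Qed.

Definition Res (E : closed_sub) (t : AutDown E) : AutUp E :=
  exist _ (Aut (restr_iso (svalP t))) (Res_up t).

Definition kerRes (E : closed_sub) : Type :=
  {t : AutDown E | sval (Res t) = aut_id E}.

Definition coset (E : closed_sub) (s : aut E) : Type :=
  {r : aut E | exists e : AutUp E, r = aut_comp (sval e) s}.

(* A global section of [O(1)|_E]: the fibre of [O(1)] at a point [p] of
   projective space is the dual of the line [p]. *)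
Record section1 (E : closed_sub) := Section1 {
  sec : forall R (x : E R), {v | sval x v} -> R;
  sec_lin : forall R (x : E R) (a : R) (u v w : {v | sval x v}),
    sval w = a *: sval u + sval v -> sec w = a * sec u + sec v;
  sec_nat : forall (R S : comAlgType k) (f : {lrmorphism R -> S}) (x : E R)
    (v : {v | sval x v}) (w : {v | sval (fmap f x) v}),
    sval w = map_mx f (sval v) -> sec w = f (sec v) }.

Lemma lin_sec_lin (E : closed_sub) (c : 'cV[k]_n.+1) R (x : E R)
    (a : R) (u v w : {v | sval x v}) :
  sval w = a *: sval u + sval v ->
  (sval w *m map_mx (in_alg R) c) 0 0
  = a * (sval u *m map_mx (in_alg R) c) 0 0 + (sval v *m map_mx (in_alg R) c) 0 0.
Proof. by move=> ->; rewrite mulmxDl -scalemxAl !mxE. Qed.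

Lemma lin_sec_nat (E : closed_sub) (c : 'cV[k]_n.+1) (R S : comAlgType k) (f : {lrmorphism R -> S})
    (x : E R) (v : {v | sval x v}) (w : {v | sval (fmap f x) v}) :
  sval w = map_mx f (sval v) ->
  (sval w *m map_mx (in_alg S) c) 0 0 = f ((sval v *m map_mx (in_alg R) c) 0 0).
Proof.
move=> ->; have -> : map_mx (in_alg S) c = map_mx f (map_mx (in_alg R) c).
  by apply/matrixP => i j; rewrite !mxE /= linearZ /= rmorph1.
by rewrite -map_mxM mxE.
Qed.

(* The restriction [V = H^0(P(V^dual), O(1)) -> H^0(E, O(1)|_E)], linear forms being
   column vectors of coefficients. *)
Definition lin_sec (E : closed_sub) (c : 'cV[k]_n.+1) : section1 E :=
  Section1 (@lin_sec_lin E c) (@lin_sec_nat E c).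

(* The image in [H^0(E, L (x) s^*L)] of the tensor
   [\sum_(i, j) r i j x_i (x) x_j], encoded by the matrix [r]: the fibre of
   [L (x) s^*L] at [x] consists of the bilinear forms on the pair of lines
   [x], [s x], and [v (x) w] is sent to [v (x) (w \o s)]. *)
Definition mu (E : closed_sub) (s : aut E) (r : 'M[k]_n.+1) (R : comAlgType k)
    (x : E R) (u : {u | sval x u}) (v : {v | sval (s R x) v}) : R :=
  \sum_i \sum_j
    r i j *: (sec (lin_sec E (delta_mx i 0)) u * sec (lin_sec E (delta_mx j 0)) v).

Definition bilin (r : 'M[k]_n.+1) (R : comAlgType k) (u v : 'rV[R]_n.+1) : R :=
  \sum_i \sum_j r i j *: (u 0 i * v 0 j).

(* The tensor algebra of the space with basis indexed by ['I_n.+1]. *)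
Local Notation TV := {malg k[fmonom 'I_n.+1]}.

Definition tensor2 (r : 'M[k]_n.+1) : TV :=
  \sum_i \sum_j mkmalgU (fmmul (fmu i) (fmu j)) (r i j).

Definition ideal_gen (Rr : {vspace 'M[k]_n.+1}) (t : TV) : Prop :=
  forall J : TV -> Prop,
    J 0 -> (forall u v, J u -> J v -> J (u - v)) ->
    (forall a u b, J u -> J (a * u * b)) ->
    (forall r, r \in Rr -> J (tensor2 r)) -> J t.

Definition tensor_eval (A : algType k) (x : 'I_n.+1 -> A) : TV -> A :=
  mmap (in_alg A) (fun m : fmonom 'I_n.+1 => \prod_(i <- m : seq 'I_n.+1) x i).

(* [A = T(V) / (Rr)] with [V] spanned by the [x_i] *)
Definition presents (A : algType k) (x : 'I_n.+1 -> A)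
    (Rr : {vspace 'M[k]_n.+1}) : Prop :=
  (forall a, exists t, tensor_eval x t = a) /\
  (forall t, tensor_eval x t = 0 <-> ideal_gen Rr t).

(* The line bundle of a triple is [O(1)|_E], hence determined by [E]. *)
Record triple := Triple { tE : closed_sub; tsigma : aut tE }.

Definition graph_cond (Rr : {vspace 'M[k]_n.+1}) (T : triple) : Prop :=
  forall (R : comAlgType k) (p q : Pn R),
    (forall r u v, r \in Rr -> p u -> q v -> bilin r u v = 0) <->
    (exists x : tE T R, sval x = p /\ sval (tsigma T R x) = q).

Definition kernel_cond (Rr : {vspace 'M[k]_n.+1}) (T : triple) : Prop :=
  bijective (lin_sec (tE T)) /\
  (forall r, r \in Rr <->
     forall R (x : tE T R) u v, mu (s := tsigma T) r (x := x) u v = 0).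

(* The basis [x] of [A_1] is the linear identification of [P(A_1^dual)] with
   [P^n]. *)
Definition associated (A : cgalg k) (T : triple) : Prop :=
  exists (x : 'I_n.+1 -> A) (Rr : {vspace 'M[k]_n.+1}),
    [/\ homog_basis 1 x, presents x Rr, graph_cond Rr T & kernel_cond Rr T].

(* A noncommutative [P^n] is the triple [(QGr A, pi A, (1))] built from its
   coordinate ring [A]; [A] is the datum recorded here. *)
Record ncPn := NcPn { nc_ring :> cgalg k; nc_ringP : coord_ring_Pn nc_ring n }.

Definition geometric (A : ncPn) : Prop := exists T, associated A T.

Record gt_obj := GtObj {
  gt_triple :> triple;
  gt_assoc : exists2 A : ncPn, geometric A & associated A gt_triple }.

Record gt_hom (T T' : gt_obj) := GtHom {
  gt_tau : nat -> aut Pn;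
  gt_into : forall i, maps_into (gt_tau i) (tE T) (tE T');
  gt_iso : forall i, is_iso (restr (gt_into i));
  gt_comm : forall i,
    hcomp (restr (gt_into i.+1)) (tsigma T)
    = hcomp (tsigma T') (restr (gt_into i)) }.

Definition slice_obj (T : gt_obj) : Type := {T' : gt_obj & gt_hom T' T}.

End ProjectiveSpace.

(* Main.v *)
(** A geometric system [tau : T' -> T] is determined by its maps [tau_i] alone:
[E'] is the preimage of [E] under [tau_0], and [sigma'] is forced by
[tau_1 sigma' = sigma tau_0]. Conjugating [sigma'] by [tau_0] gives
[tau_0 tau_1^-1 sigma], an element of the coset of [sigma]. This element and
[tau_0] recover [E'] and [sigma'], and then, by induction on [i], the restriction
of every [tau_i] to [E']. So two systems with the same such pair differ in each
degree by an element of [ker Res_E], and comparing with one chosen system for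
each pair yields the sequence in [ker Res_E]. *)

From mathcomp Require Import all_boot all_order all_algebra.
From mathcomp Require Import boolp.
Require Import Defs.

Set Implicit Arguments.
Unset Strict Implicit.
Unset Printing Implicit Defensive.

Local Open Scope ring_scope.

Lemma iso_pointwise (k : fieldType) (X Y : kfunctor k) (f : hom X Y) :
  is_iso f ->
  exists2 g : hom Y X, is_iso g & forall R, cancel (f R) (g R) /\ cancel (g R) (f R).
Proof.
move=> [g [gf fg]]; exists g; first by exists f.
move=> R; split=> x.
  by have -> : g R (f R x) = hcomp g f R x by []; rewrite gf.
by have -> : f R (g R x) = hcomp f g R x by []; rewrite fg.
Qed.

Lemma aut_ext (k : fieldType) (X : kfunctor k) (s t : aut X) :
  (forall R (x : X R), s R x = t R x) -> s = t.
Proof.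
case: s t => [s sI] [t tI] /= /hom_ext st.
by case: t / st tI => tI; congr Aut; apply: Prop_irrelevance.
Qed.

Lemma aut_inj (k : fieldType) (X : kfunctor k) (t : aut X) R : injective (t R).
Proof. by have [g _ /(_ R)[tK _]] := iso_pointwise (aiso t); apply: can_inj tK. Qed.

Lemma aut_inverse (k : fieldType) (X : kfunctor k) (t : aut X) :
  exists u : aut X, forall R, cancel (t R) (u R) /\ cancel (u R) (t R).
Proof. by have [g gI gK] := iso_pointwise (aiso t); exists (Aut gI). Qed.

(** Supplies one reference element per fibre of [key]. Equal keys turn the two existence statements
    into the same proposition, so by proof irrelevance [cid] picks the same witness. *)
Lemma choice_on_fibres (X K : Type) (key : X -> K) :
  exists s : X -> X, (forall x, key (s x) = key x) /\
    (forall x y, key x = key y -> s x = s y).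
Proof.
have H x : exists y, key y = key x by exists x.
exists (fun x => sval (cid (H x))); split=> [x|x y]; first by case: (cid (H x)).
move: (H x) (H y) => + + xy; rewrite xy => Hx Hy.
by rewrite (Prop_irrelevance Hx Hy).
Qed.

Section Restriction.
Variables (k : fieldType) (n : nat).
Implicit Types (E : closed_sub k n) (t : aut (Pn k n)).

Lemma closed_sub_ext E E' :
  (forall R (p : Pn k n R), cpt E p <-> cpt E' p) -> E = E'.
Proof.
case: E E' => [c cP] [d dP] /= cd.
have e : c = d.
  apply: functional_extensionality_dep => R.
  by apply: funext => p; apply: propext; apply: cd.
by case: d / e dP {cd} => dP; congr ClosedSub; apply: Prop_irrelevance.
Qed.

Lemma sub_ext E R (x y : E R) : sval x = sval y -> x = y.
Proof. by case: x y => [p pE] [q qE] /= pq; apply: eq_exist. Qed.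

Lemma restr_iso_onto t E E' (tE : maps_into t E E') :
  is_iso (restr tE) -> forall R (q : Pn k n R), cpt E' q ->
  exists2 p, cpt E p & t R p = q.
Proof.
move=> /iso_pointwise[g _ gK] R q qE'.
have [_ /(_ (exist _ q qE'))/(congr1 sval)/= Dq] := gK R.
by exists (sval (g R (exist _ q qE'))); first exact: svalP.
Qed.

Lemma restr_iso_cpt t E E' (tE : maps_into t E E') :
  is_iso (restr tE) -> forall R (p : Pn k n R), cpt E p <-> cpt E' (t R p).
Proof.
move=> tI R p; split=> [|tpE']; first exact: tE.
by have [q qE /aut_inj <-] := restr_iso_onto tI tpE'.
Qed.

(** The automorphism is [s] after the inverse of [t]. It serves both for the coset factor ([s], [t]
    the maps of degrees 0 and 1 of one system) and for the kernel factor (maps of equal degree of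
    two systems). *)
Lemma quotient_preserves (s t : aut (Pn k n)) E E'
    (sE : maps_into s E E') (tE : maps_into t E E') :
  is_iso (restr sE) -> is_iso (restr tE) ->
  exists2 d : aut (Pn k n), preserves d E' & forall R p, d R (t R p) = s R p.
Proof.
move=> sI tI; have [u uK] := aut_inverse t.
have du R p : aut_comp s u R (t R p) = s R p by rewrite /= (uK R).1.
exists (aut_comp s u) => // R q; split=> [[p]|].
  by move=> /(restr_iso_onto tI)[p' p'E <-] <-; rewrite du; apply: (sE).
by move=> /(restr_iso_onto sI)[p pE <-]; exists (t R p); [apply: (tE)|].
Qed.

End Restriction.

Section Slice.
Variables (k : fieldType) (n : nat) (T : gt_obj k n).
Implicit Types x y : slice_obj T.
Local Notation E := (tE T).

Definition source x : triple k n := gt_triple (projT1 x).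
Definition tau x (i : nat) : aut (Pn k n) := gt_tau (projT2 x) i.

Lemma tau_cpt x i R (p : Pn k n R) : cpt (tE (source x)) p <-> cpt E (tau x i R p).
Proof. exact: restr_iso_cpt (gt_iso (projT2 x) i) R p. Qed.

Lemma tau_comm x i R (p : tE (source x) R) (q : E R) :
  sval q = tau x i R (sval p) ->
  tau x i.+1 R (sval (tsigma (source x) R p)) = sval (tsigma T R q).
Proof.
move=> qp; have -> : q = restr (gt_into (projT2 x) i) R p by apply: sub_ext.
by have := congr1 (fun h : hom (tE (source x)) E => sval (h R p)) (gt_comm (projT2 x) i).
Qed.

Lemma slice_ext x y : (forall i, tau x i = tau y i) -> x = y.
Proof.
move=> xy.
have EE : tE (source x) = tE (source y).
  by apply: closed_sub_ext => R p; rewrite (tau_cpt x 0) xy -tau_cpt.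
have SS : source x = source y.
  (* The needed facts are generalised first, so that identifying the two subschemes puts both
     automorphisms on the same one; injectivity of [tau y 1] then compares them. *)
  move: (@tau_comm x 0) (@tau_comm y 0) (tau_cpt x 0); rewrite !xy.
  case: (source x) (source y) EE => [E1 s1] [E2 s2] /= EE.
  case: E2 / EE s2 => s2 c1 c2 t0E; congr Triple.
  apply: aut_ext => R p; apply: sub_ext; apply: (@aut_inj _ _ (tau y 1)).
  pose q : E R := exist _ _ ((t0E R (sval p)).1 (svalP p)).
  by rewrite (c1 R p q) // (c2 R p q).
case: x y SS xy {EE} => [[T1 a1] h1] [[T2 a2] h2]; rewrite /source /tau /= => SS.
case: T2 / SS a2 h2 => a2; rewrite -(Prop_irrelevance a1 a2) => h2 /funext.
case: h1 h2 => [t1 i1 j1 c1] [t2 i2 j2 c2] /= tt.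
case: t2 / tt i2 j2 c2 => i2; rewrite -(Prop_irrelevance i1 i2) => j2 c2.
by rewrite (Prop_irrelevance j1 j2) (Prop_irrelevance c1 c2).
Qed.

(** The equation says pointwise that [c] is the conjugate of the source automorphism by [tau x 0].
    It holds because [d] undoes [tau x 1] and then applies [tau x 0]. *)
Lemma conjugate_in_coset x : exists c : coset (tsigma T),
  forall R (p : tE (source x) R) (q : E R), sval q = tau x 0 R (sval p) ->
    sval (sval c R q) = tau x 0 R (sval (tsigma (source x) R p)).
Proof.
have [d dE dK] := quotient_preserves (gt_iso (projT2 x) 0) (gt_iso (projT2 x) 1).
pose c := aut_comp (sval (Res (exist _ d dE))) (tsigma T).
have cP : exists e : AutUp E, c = aut_comp (sval e) (tsigma T).
  by exists (Res (exist _ d dE)).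
exists (exist _ c cP) => R p q qp /=.
by rewrite -(tau_comm qp); apply: dK.
Qed.

Lemma tau_agree x y (c : aut E) :
  (forall R (p : tE (source x) R) (q : E R), sval q = tau x 0 R (sval p) ->
    sval (c R q) = tau x 0 R (sval (tsigma (source x) R p))) ->
  (forall R (p : tE (source y) R) (q : E R), sval q = tau y 0 R (sval p) ->
    sval (c R q) = tau y 0 R (sval (tsigma (source y) R p))) ->
  tau x 0 = tau y 0 ->
  forall i R (p : Pn k n R), cpt (tE (source x)) p -> tau x i R p = tau y i R p.
Proof.
move=> cx cy xy0; elim=> [|i IH] R p px; first by rewrite xy0.
(* Write [p] as the image of some [p'] under the source automorphism: this lowers the degree from
   [i.+1] to [i]. *)
have [g _ /(_ R)[_ /(_ (exist _ p px))]] := iso_pointwise (aiso (tsigma (source x))).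
move: (g R _) => p' /(congr1 sval)/= Dp.
have p'y : cpt (tE (source y)) (sval p').
  by rewrite (tau_cpt y 0) -xy0 -tau_cpt; apply: svalP.
pose p'' : tE (source y) R := exist _ _ p'y.
(* Both source automorphisms have the same conjugate [c] by the same map, so they agree at [p']. *)
have Dp' : sval (tsigma (source y) R p'') = p.
  pose q0 : E R := exist _ _ ((tau_cpt x 0 (sval p')).1 (svalP p')).
  apply: (@aut_inj _ _ (tau y 0)); rewrite -(cy R p'' q0) /= ?xy0 //.
  by rewrite (cx R p' q0) // Dp xy0.
pose q : E R := exist _ _ ((tau_cpt x i (sval p')).1 (svalP p')).
rewrite -{1}Dp -Dp' (@tau_comm x i R p' q) // (@tau_comm y i R p'' q) //=.
by apply: IH; apply: svalP.
Qed.

Lemma quotient_in_kerRes x y i :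
  tE (source x) = tE (source y) ->
  (forall R (p : Pn k n R), cpt (tE (source x)) p -> tau x i R p = tau y i R p) ->
  exists d : kerRes E, forall R p, sval (sval d) R (tau y i R p) = tau x i R p.
Proof.
move=> EE xy.
(* Restate the restriction of [tau y i] over the subscheme of [x], since the points of that
   subscheme are where [xy] applies. *)
have yE : maps_into (tau y i) (tE (source x)) E by rewrite EE; apply: gt_into.
have yI : is_iso (restr yE).
  by move: yE; rewrite EE => yE; rewrite (Prop_irrelevance yE (gt_into (projT2 y) i));
    apply: gt_iso.
have [d dE dK] := quotient_preserves (gt_iso (projT2 x) i) yI.
pose d' : AutDown E := exist _ d dE.
have d1 : sval (Res d') = aut_id E.
  apply: aut_ext => R [q qE]; apply: sub_ext => /=.
  by have [p pE <-] := restr_iso_onto yI qE; rewrite dK; apply: xy.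
by exists (exist _ d' d1).
Qed.

End Slice.

Theorem theorem28 (k : closedFieldType) (hk : [pchar k] =i pred0) (n : nat)
  (A : ncPn k n) (hA : geometric A) (T : gt_obj k n) (hT : associated A T) :
  exists f : slice_obj T ->
             (coset (tsigma T) * (nat -> kerRes (tE T)) * aut (Pn k n))%type,
    injective f.
Proof.
have [c cP] := choice (@conjugate_in_coset k n T).
(* [s x] is the reference system of the pair of [x]; below, [d (x, i)] carries its degree [i] map to
   that of [x]. *)
have [s [sP sE]] := choice_on_fibres (fun x => (c x, tau x 0)).
have dP (xi : slice_obj T * nat) : exists d : kerRes (tE T),
    forall R p, sval (sval d) R (tau (s xi.1) xi.2 R p) = tau xi.1 xi.2 R p.
  case: xi => x i /=; have [cs ts] := sP x.
  apply: quotient_in_kerRes.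
    by apply: closed_sub_ext => R p; rewrite (tau_cpt x 0) -ts -tau_cpt.
  apply: (@tau_agree _ _ _ _ _ (sval (c x))) => //; first exact: cP.
  by rewrite -cs; apply: cP.
have [d dE] := choice dP.
exists (fun x => (c x, (fun i => d (x, i)), tau x 0)) => x y [cxy dxy txy].
apply: slice_ext => i; apply: aut_ext => R p.
have dxyi : d (x, i) = d (y, i) := congr1 (@^~ i) dxy.
(* Equal pairs give [s x = s y], and equal corrections applied to the same reference map give equal
   maps. *)
by rewrite -(dE (x, i)) dxyi /= (sE x y) ?(dE (y, i)) // cxy txy.
Qed.
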